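(* There exists $N$ such that for every even integer $x\ge N$: if the set $\mathscr{A}(x)$ of divisibility events for $x$ is balanced, then $T<1$, where $$T=P\left(\bigcup_{i=1}^{r}A_{p_i}\right).$$
   Context: Write an even integer $x\ge 12$ as $x=12n+k$ with $n\ge 1$ and $k\in\{0,2,4,6,8,10\}$, and define the finite set $S$ (with $m$ ranging over integers) by: $k=0$: $S=\{12m+2:0\le m\le n-1\}\cup\{12m+10:0\le m\le n-1\}$; $k=2$ or $k=10$: $S=\{12m:1\le m\le n\}$; $k=4$: $S=\{12m+6:0\le m\le n-1\}$; $k=6$: $S=\{12m+4:0\le m\le n\}\cup\{12m+8:0\le m\le n-1\}$; $k=8$: $S=\{12m+6:0\le m\le n\}$. Equip $S$ with the uniform probability $P(E)=|E|/|S|$. Let $p_1=5<p_2=7<\cdots<p_r$ be the primes $p$ with $3<p<\sqrt{x}$, in increasing order (so $p_i$ is the $(i+2)$-th prime). For each such $p$ let $A_p=\{y\in S: p\mid x+y\}\cup\{y\in S: p\mid x-y,\ x-y\neq 2p\}$. The set of divisibility events for $x$ is $\mathscr{A}(x)=\{A_{p_1},\ldots,A_{p_r}\}$ (in this order). The quantity $T$ is denoted $T(n)$ in the paper. For events $A,B$ let $\lambda(A,B)=\frac{P(B)-P(A\cap B)}{P(B)-P(A)P(B)}$. A (finite, ordered) collection of events $\{A_1,\ldots,A_r\}$ is called balanced if $\lambda_i<\frac{(\log p_i)^2}{2}$ for all $i=2,3,\ldots,r$, where $\lambda_i=\lambda\big(\bigcup_{j=1}^{i-1}A_j,A_i\big)$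 and $p_i$ is the $(i+2)$-th prime (the denominators being understood to be nonzero). *)

(* Defs.v *)
From HB Require Import structures.
From mathcomp Require Import all_boot all_order all_algebra finmap.
From mathcomp Require Import reals exp zify.

Set Implicit Arguments.
Unset Strict Implicit.
Unset Printing Implicit Defensive.

Import Order.TTheory GRing.Theory Num.Theory.

Local Open Scope fset_scope.
Local Open Scope nat_scope.

Lemma next_prime_subproof n : exists p, (n < p) && prime p.
Proof. by have [p np pp] := prime_above n; exists p; rewrite np. Qed.

Definition next_prime n : nat := ex_minn (next_prime_subproof n).

(* The k-th prime, counted from 1: nth_prime 1 = 2, nth_prime 2 = 3. *)
Definition nth_prime k : nat := iter k next_prime 0.

(* The set S, for x = 12n + k. The last branch is only reached for odd x. *)
Definition sample_set (x : nat) : {fset nat} :=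
  let n := x %/ 12 in
  match x %% 12 with
  | 0 => [fset 12 * m + 2 | m in iota 0 n] `|` [fset 12 * m + 10 | m in iota 0 n]
  | 2 | 10 => [fset 12 * m | m in iota 1 n]
  | 4 => [fset 12 * m + 6 | m in iota 0 n]
  | 6 => [fset 12 * m + 4 | m in iota 0 n.+1] `|` [fset 12 * m + 8 | m in iota 0 n]
  | 8 => [fset 12 * m + 6 | m in iota 0 n.+1]
  | _ => fset0
  end.

(* Hence the truncated subtraction [x - y] in [div_event] is the integer one. *)
Lemma sample_set_lt x y : y \in sample_set x -> y < x.
Proof.
rewrite /sample_set; have := divn_eq x 12.
move: (x %/ 12) (x %% 12) => n k ->.
have step (j c : nat) (s : seq nat) :
    (forall m, m \in s -> 12 * m + c < j) ->
  y \in [fset 12 * m + c | m in s] -> y < j.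
  by move=> s_lt /imfsetP[m /= ms ->]; exact: s_lt.
have step0 (j : nat) (s : seq nat) :
    (forall m, m \in s -> 12 * m < j) ->
  y \in [fset 12 * m | m in s] -> y < j.
  by move=> s_lt /imfsetP[m /= ms ->]; exact: s_lt.
case: k => [|[|[|[|[|[|[|[|[|[|[|k]]]]]]]]]]]; rewrite ?in_fsetU ?in_fset0 //;
  by try case/orP; (apply: step0 || apply: step) => // m;
     rewrite mem_iota; lia.
Qed.

Definition div_event (x p : nat) : {fset nat} :=
  [fset y in sample_set x | p %| x + y]
  `|` [fset y in sample_set x | (p %| x - y) && (x - y != 2 * p)].

Section Events.
Variable R : realType.
Local Open Scope ring_scope.

Definition unif_prob (S E : {fset nat}) : R := #|` E|%:R / #|` S|%:R.

Definition lambda (S A B : {fset nat}) : R :=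
  let P := unif_prob S in (P B - P (A `&` B)) / (P B - P A * P B).

(* [As] lists the events A_1, ..., A_r, so A_i is [nth fset0 As i.-1]. *)
Definition balanced (S : {fset nat}) (As : seq {fset nat}) : Prop :=
  forall i : nat, (2 <= i <= size As)%N ->
  let U := \bigcup_(A <- take i.-1 As) A in
  let Ai := nth fset0 As i.-1 in
  unif_prob S Ai - unif_prob S U * unif_prob S Ai != 0 /\
  lambda S U Ai < ln (nth_prime (i + 2)%N)%:R ^+ 2 / 2.

Definition sieving_primes (x : nat) : seq nat :=
  [seq p <- iota 0 x | [&& prime p, (3 < p)%N & p%:R < Num.sqrt (x%:R : R)]].

Definition div_events (x : nat) : seq {fset nat} :=
  [seq div_event x p | p <- sieving_primes x].

Definition T (x : nat) : R :=
  unif_prob (sample_set x) (\bigcup_(A <- div_events x) A).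

End Events.

(* Main.v *)
Require Import Defs.
From mathcomp Require Import all_boot all_order all_algebra finmap.
From mathcomp Require Import reals sequences exp.
From mathcomp Require Import zify lra.

(** The theorem holds because only the last event matters.  Write [U] for the
    union of all the events but the last one, [A] for the last one, attached to
    the largest sieving prime [p], and [lam] for [lambda(U, A)].
    Inclusion-exclusion and the definition of [lambda] give

      1 - P(U u A) = (1 - P(U)) (1 - lam P(A)).

    The denominator [P(A) (1 - P(U))] of [lam] is nonzero by the balance
    hypothesis, so [P(U) < 1] comes for free, without any induction on the
    events; it remains to see that [lam P(A) < 1] ([unif_prob_fsetU_lt1]).

    By balance, [lam] is less than [(ln q) ^ 2 / 2], where [q] is the prime of
    rank [r + 2] for [r] sieving primes, so that [q <= p] ([nth_prime_le]).  The
    two congruences modulo [p] that define [A] give [P(A)] about [2 / p]; as [p < sqrt x] is small compared with the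
    length of the arithmetic progressions that make up [S], the rounding errors
    only raise this to at most [5 / (2 p)] ([div_event_card]).  Finally
    [(ln p) ^ 2 / p] is at most [4 / e ^ 2], which is about [0.541]; the bound
    [64 / 81] of [sqr_ln_le], with the elementary [9 / 4] in place of [e], is
    sufficient, since [64 / 81 * 5 / 4 = 80 / 81 < 1]. *)

Set Implicit Arguments.
Unset Strict Implicit.
Unset Printing Implicit Defensive.

Import Order.TTheory GRing.Theory Num.Theory.

Local Open Scope fset_scope.
Local Open Scope nat_scope.

(** * Counting multiples of a prime along arithmetic progressions *)

Definition progression (c a L : nat) : {fset nat} :=
  [fset 12 * m + c | m in iota a L].

Lemma card_progression c a L : #|` progression c a L| = L.
Proof.
rewrite card_in_imfset /= => [|m m' _ _]; last by lia.
by rewrite undup_id ?iota_uniq// size_iota.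
Qed.

(** The quotients [(m - a) %/ p] are pairwise distinct when the terms
    [12 * m + c] are congruent modulo [p], because [12] is invertible there, and
    they take at most [L %/ p + 1] values. *)
Lemma card_congruent_terms (E : {fset nat}) c a L p :
  coprime p 12 -> 0 < p -> E `<=` progression c a L ->
  {in E &, forall y y', y = y' %[mod p]} -> #|` E| <= L %/ p + 1.
Proof.
move=> p12 p0 /fsubsetP sE cE.
pose f y := ((y - c) %/ 12 - a) %/ p.
have decE y : y \in E -> exists2 m, y = 12 * m + c & a <= m < a + L.
  by move=> /sE /imfsetP[m /=]; rewrite mem_iota => mL ->; exists m.
have fE m : f (12 * m + c) = (m - a) %/ p by rewrite /f addnK mulKn.
have f_inj : {in E &, injective f}.
  move=> y y' yE y'E; wlog le_yy' : y y' yE y'E / y' <= y.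
    move=> wl fyy'; case/orP: (leq_total y' y) => [|/wl] le_yy'.
      exact: wl.
    by rewrite le_yy'.
  have := cE _ _ yE y'E.
  have [m ym /andP[am _]] := decE _ yE; have [m' ym' /andP[am' _]] := decE _ y'E.
  rewrite ym ym' !fE in le_yy' *.
  have le_mm' : m' <= m by lia.
  move=> /eqP; rewrite eqn_modDr eqn_mod_dvd ?leq_mul// -mulnBr Gauss_dvdr//.
  case/dvdnP => t mt; have -> : m - a = t * p + (m' - a) by lia.
  rewrite divnMDl// => tE; have t0 : t = 0 by lia.
  by rewrite t0 in mt; congr (12 * _ + _); lia.
rewrite -(size_map f); apply: leq_trans (_ : size (iota 0 (L %/ p + 1)) <= _).
  apply: uniq_leq_size; first by rewrite map_inj_in_uniq ?fset_uniq.
  move=> _ /mapP[y /decE[m -> /andP[am mL]] ->]; rewrite mem_iota fE add0n /=.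
  by rewrite addn1 ltnS leq_div2r// leq_subLR ltnW.
by rewrite size_iota.
Qed.

Definition hits x p y := (p %| x + y) || (p %| x - y).

(** Each of the two conditions [p %| x + y] and [p %| x - y] fixes the residue of
    [y] modulo [p], so that at most [2 * (L %/ p + 1)] terms qualify; and
    [2 * p * (2 * (L %/ p + 1)) <= 4 * L + 4 * p <= 5 * L]. *)
Lemma card_hits_progression x p c a L :
    coprime p 12 -> 0 < p -> 4 * p <= L ->
    {in progression c a L, forall y, y <= x} ->
  2 * p * #|` [fset y in progression c a L | hits x p y]|
    <= 5 * #|` progression c a L|.
Proof.
move=> p12 p0 pL le_x; set A := progression c a L.
have cardD : #|` [fset y in A | p %| x + y]| <= L %/ p + 1.
  apply: (card_congruent_terms (c := c) (a := a)) => //.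
    by apply/fsubsetP => y; rewrite !inE => /andP[].
  move=> y y'; rewrite !inE => /andP[_ dy] /andP[_ dy'].
  by apply/eqP; rewrite -(eqn_modDl x) (eqP dy) (eqP dy').
have cardB : #|` [fset y in A | p %| x - y]| <= L %/ p + 1.
  apply: (card_congruent_terms (c := c) (a := a)) => //.
    by apply/fsubsetP => y; rewrite !inE => /andP[].
  move=> y y'; rewrite !inE => /andP[/le_x yx dy] /andP[/le_x yx' dy'].
  by transitivity (x %% p); [symmetry|]; apply/eqP; rewrite eqn_mod_dvd.
have -> : [fset y in A | hits x p y] =
    [fset y in A | p %| x + y] `|` [fset y in A | p %| x - y].
  by apply/fsetP => y; rewrite !inE /hits andb_orr.
have [leU _] :=
  leq_card_fsetU [fset y in A | p %| x + y] [fset y in A | p %| x - y].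
rewrite card_progression; have := leq_divM L p; nia.
Qed.

Lemma card_hitsU x p (S1 S2 : {fset nat}) : [disjoint S1 & S2] ->
  2 * p * #|` [fset y in S1 | hits x p y]| <= 5 * #|` S1| ->
  2 * p * #|` [fset y in S2 | hits x p y]| <= 5 * #|` S2| ->
  2 * p * #|` [fset y in S1 `|` S2 | hits x p y]| <= 5 * #|` S1 `|` S2|.
Proof.
rewrite -fsetI_eq0 => /eqP S12 le1 le2.
have -> : [fset y in S1 `|` S2 | hits x p y] =
    [fset y in S1 | hits x p y] `|` [fset y in S2 | hits x p y].
  by apply/fsetP => y; rewrite !inE andb_orl.
have [leU _] :=
  leq_card_fsetU [fset y in S1 | hits x p y] [fset y in S2 | hits x p y].
by have := cardfsUI S1 S2; rewrite S12 cardfs0; nia.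
Qed.

Lemma card_hits_sample_set x p : ~~ odd x -> coprime p 12 -> 0 < p ->
  4 * p <= x %/ 12 ->
  2 * p * #|` [fset y in sample_set x | hits x p y]| <= 5 * #|` sample_set x|.
Proof.
move=> x_even p12 p0 pn; have S_lt := @sample_set_lt x; rewrite /sample_set in S_lt *.
have disj c d a b L M : c %% 12 != d %% 12 ->
    [disjoint progression c a L & progression d b M].
  move=> cd; apply/fdisjointP => _ /imfsetP[m _ ->].
  apply: contra cd => /imfsetP[m' _ /(congr1 (modn^~ 12))].
  by rewrite ![12 * _]mulnC !modnMDl => ->.
have one c a L : 4 * p <= L -> {in progression c a L, forall y, y < x} ->
    2 * p * #|` [fset y in progression c a L | hits x p y]|
      <= 5 * #|` progression c a L|.
  by move=> pL ltx; apply: card_hits_progression => // y /ltx/ltnW.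
have two c d a b L M : c %% 12 != d %% 12 -> 4 * p <= L -> 4 * p <= M ->
    {in progression c a L `|` progression d b M, forall y, y < x} ->
    2 * p * #|` [fset y in progression c a L `|` progression d b M | hits x p y]|
      <= 5 * #|` progression c a L `|` progression d b M|.
  move=> cd pL pM ltx; apply: card_hitsU (disj _ _ _ _ _ _ cd) _ _; apply: one => //.
    by move=> y yA; apply: ltx; rewrite inE yA.
  by move=> y yA; apply: ltx; rewrite inE yA orbT.
have zero a L : [fset 12 * m | m in iota a L] = progression 0 a L.
  by apply: eq_imfset => // m; rewrite addn0.
have pn1 : 4 * p <= (x %/ 12).+1 by lia.
have k_even : ~~ odd (x %% 12) by move: x_even; rewrite {1}(divn_eq x 12) oddD oddM andbF.
have k_lt : x %% 12 < 12 by rewrite ltn_pmod.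
move: (x %% 12) k_even k_lt S_lt.
do 12?[case=> //=]; rewrite ?zero => _ _ S_lt.
- exact: (two 2 10 0 0 _ _ isT pn pn S_lt).
- exact: (one 0 1 _ pn S_lt).
- exact: (one 6 0 _ pn S_lt).
- exact: (two 4 8 0 0 _ _ isT pn1 pn S_lt).
- exact: (one 6 0 _ pn1 S_lt).
- exact: (one 0 1 _ pn S_lt).
Qed.

Local Open Scope ring_scope.

(** * The events as subsets of [S] *)

Lemma div_event_sub x p : div_event x p `<=` sample_set x.
Proof. by apply/fsubsetP => y; rewrite !inE => /orP[] /andP[]. Qed.

Lemma div_event_card x p :
  ~~ odd x -> coprime p 12 -> (0 < p)%N -> (4 * p <= x %/ 12)%N ->
  (2 * p * #|` div_event x p| <= 5 * #|` sample_set x|)%N.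
Proof.
move=> x_even p12 p0 pn; apply: leq_trans (card_hits_sample_set x_even p12 p0 pn).
rewrite leq_mul2l fsubset_leq_card ?orbT//; apply/fsubsetP => y.
by rewrite !inE /hits => /orP[/andP[-> ->]//|/and3P[-> -> _]]; rewrite orbT.
Qed.

Section Probability.
Variable R : realType.

(** * Probability of a union with one more event *)

Lemma unif_prob_ge0 (S E : {fset nat}) : 0 <= unif_prob R S E.
Proof. by rewrite divr_ge0. Qed.

Lemma unif_prob_le1 (S E : {fset nat}) : E `<=` S -> unif_prob R S E <= 1.
Proof.
move=> /fsubset_leq_card ES; rewrite /unif_prob.
have [->|S0] := posnP #|` S|; first by rewrite invr0 mulr0.
by rewrite ler_pdivrMr ?ltr0n// mul1r ler_nat.
Qed.

Lemma unif_prob_fsetU (S A B : {fset nat}) : unif_prob R S (A `|` B) =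
  unif_prob R S A + unif_prob R S B - unif_prob R S (A `&` B).
Proof.
by apply/eqP; rewrite eq_sym subr_eq /unif_prob -!mulrDl -!natrD cardfsUI.
Qed.

Lemma unif_prob_div_event x p :
  ~~ odd x -> coprime p 12 -> (0 < p)%N -> (4 * p <= x %/ 12)%N ->
  p%:R * unif_prob R (sample_set x) (div_event x p) <= 5 / 2.
Proof.
move=> x_even p12 p0 pn; rewrite /unif_prob.
have [->|S0] := posnP #|` sample_set x|; first by rewrite invr0 !mulr0; lra.
rewrite mulrA ler_pdivrMr ?ltr0n//.
have := div_event_card x_even p12 p0 pn.
rewrite -(ler_nat R) !natrM; lra.
Qed.

(** The factorization [1 - P(U u A) = (1 - P(U)) (1 - lambda(U, A) P(A))]; the
    nonzero denominator makes the first factor positive. *)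
Lemma unif_prob_fsetU_lt1 (S U A : {fset nat}) : U `<=` S ->
  unif_prob R S A - unif_prob R S U * unif_prob R S A != 0 ->
  lambda R S U A * unif_prob R S A < 1 ->
  unif_prob R S (U `|` A) < 1.
Proof.
move=> /unif_prob_le1 U_le1 D_neq0 lamA; rewrite unif_prob_fsetU.
have U_lt1 : unif_prob R S U < 1.
  rewrite lt_neqAle U_le1 andbT; apply: contraNneq D_neq0 => ->.
  by rewrite mul1r subrr.
have lamD :
    lambda R S U A * (unif_prob R S A - unif_prob R S U * unif_prob R S A) =
    unif_prob R S A - unif_prob R S (U `&` A).
  by rewrite /lambda divfK.
by nra.
Qed.

(** * Size of the logarithm *)

(** With [y = ln t] and [u = 1 + y / 6], the bound follows from [y <= 8 / 9 * u ^ 3],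
    that is [(2 * u - 3) ^ 2 * (u + 3) >= 0], and from [u <= expR (y / 6)]: they
    give [y <= 8 / 9 * expR (y / 2)]. *)
Lemma sqr_ln_le (t : R) : 1 <= t -> ln t ^+ 2 <= 64 / 81 * t.
Proof.
move=> t1; have t0 : 0 < t by apply: lt_le_trans t1.
have := ln_ge0 t1; rewrite -{3}(lnK (x := t)) ?posrE//.
move: (ln t) => {t t1 t0} y y0.
have -> : expR y = (expR (y / 6) ^+ 3) ^+ 2.
  by rewrite -exprM -expRM_natl; congr expR; lra.
have : 1 + y / 6 <= expR (y / 6) by exact: expR_ge1Dx.
move: (expR _) => e ue.
have u3 : (1 + y / 6) ^+ 3 <= e ^+ 3 by rewrite lerXn2r ?nnegrE; lra.
have ye : y <= 8 / 9 * e ^+ 3.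
  have : 0 <= (y / 3 - 1) ^+ 2 * (y / 6 + 4) by rewrite mulr_ge0 ?sqr_ge0; lra.
  move: u3; move: (e ^+ 3) => e3; lra.
by move: ye; move: (e ^+ 3) => e3; nra.
Qed.

(** * Ranks of the sieving primes *)

Lemma next_prime_le n p : (n < p)%N -> prime p -> (next_prime n <= p)%N.
Proof.
by move=> np pp; rewrite /next_prime; case: ex_minnP => m _; apply; rewrite np.
Qed.

Lemma next_prime_gt n : (n < next_prime n)%N.
Proof. by rewrite /next_prime; case: ex_minnP => m /andP[]. Qed.

(** An increasing sequence of primes greater than [3] may skip primes, but its
    entry of index [i] has at least the primes [2] and [3] and the [i] previous
    entries below it. *)
Lemma nth_prime_le (s : seq nat) i :
  all prime s -> all (ltn 3) s -> sorted ltn s -> (i < size s)%N ->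
  (nth_prime (i + 3) <= nth 0 s i)%N.
Proof.
move=> s_prime s_gt3 s_sorted; elim: i => [|i IHi] lti.
  apply: next_prime_le (all_nthP 0%N s_prime _ lti).
  apply: leq_ltn_trans (all_nthP 0%N s_gt3 _ lti).
  by apply: next_prime_le => //; apply: next_prime_le.
apply: next_prime_le (all_nthP 0%N s_prime _ lti).
apply: leq_ltn_trans (IHi (ltnW lti)) _.
exact: (sorted_ltn_nth ltn_trans) s_sorted _ _ (ltnW lti) lti (leqnn _).
Qed.

Lemma mem_sieving_primes x p :
  (p \in sieving_primes R x) = [&& prime p, (3 < p)%N & (p ^ 2 < x)%N].
Proof.
rewrite mem_filter mem_iota /= add0n.
have -> : (p%:R < Num.sqrt (x%:R : R)) = (p ^ 2 < x)%N.
  rewrite -(ltr_nat R) natrX -[X in X < Num.sqrt _]ger0_norm// -sqrtr_sqr.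
  have [->|x0] := posnP x; last by rewrite ltr_sqrt ?ltr0n.
  by rewrite sqrtr0 !ltNge sqrtr_ge0 sqr_ge0.
rewrite -!andbA; case: prime => //=; case: ltnP => //= p3.
by case: ltnP => //= p2x; nia.
Qed.

End Probability.

Theorem theorem6p13 (R : realType) :
  exists N : nat, forall x : nat, (12 <= x)%N -> ~~ odd x -> (N <= x)%N ->
    balanced R (sample_set x) (div_events R x) -> (T R x < 1)%R.
Proof.
(* If [x %/ 12 < 4 * p] and [p ^ 2 < x], then [p ^ 2 < 48 * p], hence [p < 48]
   and [x < 12 * 4 * 48 = 2304]; so [2400 <= x] gives [4 * p <= x %/ 12]. *)
exists 2400%N => x _ x_even x_ge; rewrite /T /balanced /div_events.
have memP p : p \in sieving_primes R x -> [/\ prime p, 3 < p & p ^ 2 < x]%N.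
  by rewrite mem_sieving_primes => /and3P.
have size_ge2 : (2 <= size (sieving_primes R x))%N.
  apply: (uniq_leq_size (s1 := [:: 5; 7])) => // p.
  rewrite mem_sieving_primes !inE => /orP[] /eqP-> /=; lia.
have s_sorted : sorted ltn (sieving_primes R x).
  exact: (sorted_filter ltn_trans) (iota_ltn_sorted _ _).
move: (sieving_primes R x) memP size_ge2 s_sorted; case/lastP => // s p memP.
rewrite size_rcons => size_ge2 s_sorted.
have s_prime : all prime (rcons s p) by apply/allP => q /memP[].
have s_gt3 : all (ltn 3) (rcons s p) by apply/allP => q /memP[].
have [p_prime p_gt3 p2x] : [/\ prime p, 3 < p & p ^ 2 < x]%N.
  by apply: memP; rewrite mem_rcons mem_head.
have q_le : (nth_prime (size s + 3) <= p)%N.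
  have := nth_prime_le s_prime s_gt3 s_sorted (_ : size s < _)%N.
  by rewrite size_rcons nth_rcons ltnn eqxx; apply.
have p12 : coprime p 12.
  by rewrite prime_coprime// -[12%N]/(2 * (2 * 3))%N !Euclid_dvdM// !gtnNdvd//; lia.
move=> /(_ (size s).+1); rewrite map_rcons size_rcons size_map leqnn andbT ltnS.
rewrite -[X in take X](size_map (div_event x)) -cats1 take_size_cat// nth_cat.
rewrite !size_map ltnn subnn /= => /(_ size_ge2)[D_neq0 lam_lt].
rewrite big_cat big_seq1 /=; apply: unif_prob_fsetU_lt1 D_neq0 _.
  by apply/bigfcupsP => _ /mapP[q _ ->] _; exact: div_event_sub.
have pn : (4 * p <= x %/ 12)%N by nia.
have PA_le := unif_prob_div_event R x_even p12 (prime_gt0 p_prime) pn.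
have PA_ge0 := unif_prob_ge0 R (sample_set x) (div_event x p).
have p_ge1 : 1 <= (p%:R : R) by rewrite ler1n prime_gt0.
have ln_q : ln ((nth_prime (size s).+3)%:R : R) ^+ 2 <= 64 / 81 * p%:R.
  rewrite addn3 in q_le; apply: le_trans (sqr_ln_le p_ge1).
  have q_gt0 : (0 < nth_prime (size s).+3)%N.
    exact: leq_ltn_trans (next_prime_gt _).
  have lnqp : ln (nth_prime (size s).+3)%:R <= ln p%:R :> R.
    by rewrite ler_ln ?posrE ?ltr0n ?ler_nat// prime_gt0.
  by rewrite lerXn2r// nnegrE ln_ge0// ler1n.
rewrite addn2 -[next_prime _]/(nth_prime (size s).+3) in lam_lt.
have lam_le := le_trans (ltW lam_lt) (ler_wpM2r (_ : 0 <= 2^-1) ln_q).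
have := ler_wpM2r PA_ge0 (lam_le _); rewrite invr_ge0 ler0n => /(_ isT) lamA_le.
lra.
Qed.
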